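(* Let $f,g,h$ be real-valued measurable functions on $[a,b]$ with $h(s)\ne0$ for $s\in[a,b]$. Assume that $\frac fh$ and $\frac gh$ are Hölder continuous on $[a,b]$ of orders $p,q\in(0,1]$ with Hölder constants $H_1,H_2>0$, respectively. Let $\alpha>1$ and $\frac1\alpha+\frac1\beta=1$. Then: (i) if $h\in L^\infty[a,b]$, $$\left|\widehat{\mathcal{P}}_h(f,g)\right|\le H_1H_2\,\frac{(b-a)^{p+q+2}}{\sqrt{(2p+1)(2p+2)(2q+1)(2q+2)}}\,\|h\|_\infty^4;$$ (ii) if $h\in L^{2\beta}[a,b]$, $$\left|\widehat{\mathcal{P}}_h(f,g)\right|\le H_1H_2\,\frac{2^{-1/\beta}(b-a)^{p+q+\frac2\alpha}}{\left[(2\alpha p+1)(2\alpha p+2)(2\alpha q+1)(2\alpha q+2)\right]^{\frac{1}{2\alpha}}}\,\|h\|_{2\beta}^4;$$ (iii) if $h\in L^2[a,b]$, $$\left|\widehat{\mathcal{P}}_h(f,g)\right|\le\frac12H_1H_2\,(b-a)^{p+q}\,\|h\|_2^4.$$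
   Context: For real functions $f,g,h$ on $[a,b]$ ($a<b$), the (generalized Pompeiu–Chebyshev) functional is $$\widehat{\mathcal{P}}_h(f,g)=\int_a^b h^2(x)\,dx\int_a^b f(t)g(t)\,dt-\int_a^b f(t)h(t)\,dt\int_a^b h(x)g(x)\,dx.$$ $F$ is Hölder continuous of order $p$ with constant $H$ if $|F(x)-F(t)|\le H|x-t|^p$ for all $x,t\in[a,b]$. $\|h\|_\infty$ and $\|h\|_p=\left(\int_a^b|h(t)|^p\,dt\right)^{1/p}$ are the usual Lebesgue norms on $[a,b]$. *)

(* Defs.v *)
From HB Require Import structures.
From mathcomp Require Import all_boot all_order all_algebra.
From mathcomp Require Import all_classical all_reals all_analysis.

Set Implicit Arguments.
Unset Strict Implicit.
Unset Printing Implicit Defensive.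

Import Order.TTheory GRing.Theory Num.Theory.
Import numFieldNormedType.Exports.

Local Open Scope classical_set_scope.
Local Open Scope ring_scope.

(* lebesgue_measure lives on the Borel sets only; its completion is used so that
   "measurable" means Lebesgue measurable. LebesgueR R is the carrier R equipped
   with the sigma-algebra of Lebesgue measurable sets. *)
Definition LebesgueR (R : realType) :=
  caratheodory_type ((@wlength R idfun)^*)%mu.
HB.instance Definition _ (R : realType) := Measurable.on (LebesgueR R).

Notation Leb R :=
  (@completed_lebesgue_measure R : {measure set (LebesgueR R) -> \bar R}).

Section Defs.
Context {R : realType}.
Implicit Types (a b : R) (f g h : R -> R).

Definition Lebesgue_measurable_on a b f : Prop :=
  measurable_fun (`[a, b] : set (LebesgueR R)) (f : LebesgueR R -> R).

(* The integrals are taken in \bar R, so that an upper bound on the absolute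
   value of the functional is not met by default when an integral fails to be
   finite. *)
Definition Pompeiu_Chebyshev a b h f g : \bar R :=
  ((\int[Leb R]_(x in `[a, b]) ((h x) ^+ 2)%:E) *
   (\int[Leb R]_(t in `[a, b]) (f t * g t)%:E) -
   (\int[Leb R]_(t in `[a, b]) (f t * h t)%:E) *
   (\int[Leb R]_(x in `[a, b]) (h x * g x)%:E))%E.

Definition holder_on a b (H p : R) (F : R -> R) : Prop :=
  forall x t : R, x \in `[a, b] -> t \in `[a, b] ->
    `|F x - F t| <= H * `|x - t| `^ p.

(* A function on [a, b] is identified with its extension by 0 to the whole
   line: for 1 <= p <= +oo this changes neither membership in L^p nor the
   L^p norm. *)
Definition in_Lp a b (p : \bar R) h : Prop :=
  (h \_ `[a, b] : LebesgueR R -> R) \in Lfun (Leb R) p.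

Definition Lp_norm a b (p : \bar R) h : \bar R :=
  ('N[Leb R]_p [EFin \o (h \_ `[a, b])])%E.

End Defs.

(* Main.v *)
Require Import Defs.
From mathcomp Require Import all_boot all_order all_algebra.
From mathcomp Require Import all_classical all_reals all_analysis.
From mathcomp Require Import measurable_realfun ess_sup_inf ring.
Import Order.TTheory GRing.Theory Num.Theory.
Import numFieldNormedType.Exports.
Local Open Scope classical_set_scope.
Local Open Scope ring_scope.

(** Put F = f / h, G = g / h and w = h^2 > 0. Then f g = w F G, f h = w F and
h g = w G, so the functional is the weighted Chebyshev functional of F and G,
and Korkine's identity reads
  2 P = \int \int w(x) w(t) (F x - F t) (G x - G t) dx dt.
Bounding the two differences by the Hoelder conditions leaves
  2 |P| <= H1 H2 \int \int w(x) w(t) |x - t|^(p + q) dx dt,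
and the three parts are three ways to bound this double integral:
- for h in L^2, |x - t|^(p + q) <= (b - a)^(p + q);
- for h in L^oo, w <= ||h||_oo^2 almost everywhere;
- for h in L^(2 beta), Hoelder's inequality for the exponents alpha and beta,
  with w^beta = |h|^(2 beta).
The last two use, with s = p + q and s = alpha (p + q) respectively,
  \int \int |x - t|^s dx dt = 2 (b - a)^(s + 2) / ((s + 1) (s + 2)).
The resulting constants involve p and q through p + q; they are at most the
stated ones because (2 x + c) (2 y + c) <= (x + y + c)^2, used for c = 1 and
c = 2 (four_factors_le).

All double integrals are iterated integrals, and a bound k(t) on the inner
one is integrated in its place (iterated_integral_le). Korkine's identity then
is two successive expansions by linearity
(chebyshev_le_iterated_integral), and Hoelder's inequality is applied once to
the inner and once to the outer integral (iterated_integral_le_Lp), so that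
neither a product measure nor Fubini's theorem enters. *)

(** * Korkine's identity on iterated integrals *)

Lemma Rintegral_linear4 d (T : measurableType d) (R : realType)
    (mu : {measure set T -> \bar R}) (D : set T) (mD : measurable D)
    (u v y z : T -> R) (k l m n : R) :
  mu.-integrable D (EFin \o u) -> mu.-integrable D (EFin \o v) ->
  mu.-integrable D (EFin \o y) -> mu.-integrable D (EFin \o z) ->
  mu.-integrable D
    (EFin \o (fun x => k * u x + l * v x + (m * y x + n * z x))) /\
  \int[mu]_(x in D) (k * u x + l * v x + (m * y x + n * z x)) =
    k * \int[mu]_(x in D) u x + l * \int[mu]_(x in D) v x
    + (m * \int[mu]_(x in D) y x + n * \int[mu]_(x in D) z x).
Proof.
move=> iu iv iy iz.
have iZ c f : mu.-integrable D (EFin \o f) ->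
    mu.-integrable D (EFin \o (fun x => c * f x)).
  by move=> fi; apply: eq_integrable (integrableZl mD c fi).
have iD f g : mu.-integrable D (EFin \o f) -> mu.-integrable D (EFin \o g) ->
    mu.-integrable D (EFin \o (fun x => f x + g x)).
  by move=> fi gi; apply: eq_integrable (integrableD mD fi gi).
have := (iZ k _ iu, iZ l _ iv, iZ m _ iy, iZ n _ iz) => -[[[ku lv] my] nz].
split; first by apply: (iD _ _ (iD _ _ ku lv) (iD _ _ my nz)).
rewrite (RintegralD mD (iD _ _ ku lv) (iD _ _ my nz)).
by rewrite !RintegralD// !RintegralZl.
Qed.

(** This stands for \int \int w(x) w(t) K(x, t) dx dt <= c. The inner integral
is represented by a measurable majorant k, which the outer one integrates. *)
Definition iterated_integral_le {d} {T : measurableType d} {R : realType}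
    (mu : {measure set T -> \bar R}) (D : set T) (w : T -> R) (K : T -> T -> R)
    (c : R) : Prop :=
  exists k : T -> R, [/\ measurable_fun D k,
    forall t, D t -> (\int[mu]_(x in D) (w x * K x t)%:E <= (k t)%:E)%E &
    (\int[mu]_(t in D) (w t * k t)%:E <= c%:E)%E].

(** For fixed t the inner integral of w(x) (F x - F t) (G x - G t) expands by
linearity to E - F t C - G t B + F t G t A, where A, B, C and E are the
integrals of w, w F, w G and w F G; integrated against w(t) this becomes
2 (A E - B C). *)
Lemma chebyshev_le_iterated_integral d (T : measurableType d) (R : realType)
    (mu : {measure set T -> \bar R}) (D : set T) (mD : measurable D)
    (w F G : T -> R) (K : T -> T -> R) (H c : R) :
  (forall x, D x -> 0 <= w x) ->
  mu.-integrable D (EFin \o w) ->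
  mu.-integrable D (EFin \o (fun x => w x * F x)) ->
  mu.-integrable D (EFin \o (fun x => w x * G x)) ->
  mu.-integrable D (EFin \o (fun x => w x * (F x * G x))) ->
  0 < H -> (forall t, measurable_fun D (K ^~ t)) ->
  (forall x t, D x -> D t -> `|(F x - F t) * (G x - G t)| <= H * K x t) ->
  iterated_integral_le mu D w K c ->
  2 * `|(\int[mu]_(x in D) w x) * (\int[mu]_(x in D) (w x * (F x * G x)))
     - (\int[mu]_(x in D) (w x * F x)) * (\int[mu]_(x in D) (w x * G x))|
    <= H * c.
Proof.
move=> w0 iw iF iG iFG H0 mK FGK [k [mk hk kc]].
set A := (\int[mu]_(x in D) w x)%R.
set B := (\int[mu]_(x in D) (w x * F x))%R.
set C := (\int[mu]_(x in D) (w x * G x))%R.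
set E := (\int[mu]_(x in D) (w x * (F x * G x)))%R.
have mw : measurable_fun D w.
  by apply/measurable_EFinP; exact: (measurable_int _ iw).
have HK0 x t : D x -> D t -> 0 <= K x t.
  move=> Dx Dt; rewrite -(pmulr_rge0 _ H0).
  by rewrite (le_trans _ (FGK _ _ Dx Dt)).
(* L t is the inner integral of w(x) (F x - F t) (G x - G t). *)
pose L t := 1 * E + - F t * C + (- G t * B + F t * G t * A).
have leL t : D t -> `|L t| <= H * k t.
  move=> Dt; rewrite -lee_fin EFinM.
  apply: (@le_trans _ _ (H%:E * \int[mu]_(x in D) (w x * K x t)%:E)%E); last first.
    by apply: lee_wpmul2l (hk _ Dt); rewrite lee_fin ltW.
  rewrite -ge0_integralZl_EFin ?(ltW H0)//; last 2 first.
  - by move=> x Dx; rewrite lee_fin mulr_ge0 ?w0 ?HK0.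
  - by apply/measurable_EFinP; exact: measurable_funM.
  have [iL EL] := @Rintegral_linear4 _ _ _ mu _ mD _ _ _ _
    1 (- F t) (- G t) (F t * G t) iFG iG iF iw.
  rewrite /L -EL EFin_normr_Rintegral//.
  have mL := measurable_int _ iL.
  apply: le_trans (le_abse_integral mu mD mL) _.
  apply: ge0_le_integral => //.
  - exact: measurableT_comp.
  - by apply: measurable_funeM; apply/measurable_EFinP; exact: measurable_funM.
  - move=> x Dx /=; rewrite -EFinM lee_fin [leRHS]mulrCA.
    apply: le_trans (ler_wpM2l (w0 _ Dx) (FGK _ _ Dx Dt)).
    rewrite -[w x in leRHS]ger0_norm ?w0// -normrM le_eqVlt; apply/orP; left.
    by apply/eqP; congr (`| _ |); ring.
(* The outer integral of w(t) L(t), in the form E w - C wF - B wG + A wFG. *)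
have [iL EL] := @Rintegral_linear4 _ _ _ mu _ mD _ _ _ _
  E (- C) (- B) A iw iF iG iFG.
have EL2 : (E * A + - C * B + (- B * C + A * E)) = 2 * (A * E - B * C) by ring.
have -> : 2 * `|A * E - B * C| = `|2 * (A * E - B * C)|.
  by rewrite normrM ger0_norm.
rewrite -lee_fin -EL2 -EL EFin_normr_Rintegral//.
have mL := measurable_int _ iL.
apply: le_trans (le_abse_integral mu mD mL) _.
rewrite EFinM; apply: le_trans (lee_wpmul2l _ kc); last by rewrite lee_fin ltW.
rewrite -ge0_integralZl_EFin ?(ltW H0)//; last 2 first.
- move=> t Dt; rewrite lee_fin mulr_ge0 ?w0// -(pmulr_rge0 _ H0).
  by rewrite (le_trans _ (leL _ Dt)).
- by apply/measurable_EFinP; exact: measurable_funM.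
apply: ge0_le_integral => //.
- exact: measurableT_comp.
- by apply: measurable_funeM; apply/measurable_EFinP; exact: measurable_funM.
- move=> t Dt /=; rewrite -EFinM lee_fin [leRHS]mulrCA.
  apply: le_trans (ler_wpM2l (w0 _ Dt) (leL _ Dt)).
  rewrite -[w t in leRHS]ger0_norm ?w0// -normrM le_eqVlt; apply/orP; left.
  by apply/eqP; congr (`| _ |); rewrite /L; ring.
Qed.

(** * Bounds on weighted iterated integrals *)

Lemma hoelder_integral d (T : measurableType d) (R : realType)
    (mu : {measure set T -> \bar R}) (D : set T) (u v : T -> R) (p q : R) :
  measurable D -> measurable_fun D u -> measurable_fun D v ->
  (forall x, 0 <= u x) -> (forall x, 0 <= v x) ->
  0 < p -> 0 < q -> p^-1 + q^-1 = 1 ->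
  (\int[mu]_(x in D) (u x * v x)%:E <=
   (\int[mu]_(x in D) (u x `^ p)%:E) `^ p^-1 *
   (\int[mu]_(x in D) (v x `^ q)%:E) `^ q^-1)%E.
Proof.
move=> mD m_u mv u0 v0 p0 q0 pq.
have powE (f : T -> R) (r : R) : (forall x, 0 <= f x) -> 0 < r ->
    'N[mu]_(r%:E)[EFin \o (f \_ D)]%E =
    ((\int[mu]_(x in D) (f x `^ r)%:E) `^ r^-1)%E.
  move=> f0 r0; rewrite unlock [in RHS]integral_mkcond.
  congr (_ `^ _)%E; apply: eq_integral => x _.
  rewrite /= !patchE; case: ifPn => _; first by rewrite ger0_norm.
  by rewrite normr0 powR0 ?gt_eqF.
rewrite -!powE//.
apply: le_trans (hoelder _ _ _ p0 q0 pq); last 2 first.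
- exact/(measurable_restrictT _ _).1.
- exact/(measurable_restrictT _ _).1.
rewrite Lnorm1 integral_mkcond le_eqVlt; apply/orP; left; apply/eqP.
apply: eq_integral => x _; rewrite /= !patchE.
by case: ifPn => _; [rewrite ger0_norm// mulr_ge0|rewrite mul0r normr0].
Qed.

Section iterated_integral_bounds.
Context d {T : measurableType d} {R : realType}.
Variables (mu : {measure set T -> \bar R}) (D : set T) (w : T -> R).
Variable K : T -> T -> R.
Hypotheses (mD : measurable D) (w0 : forall x, 0 <= w x).
Hypotheses (K0 : forall x t, 0 <= K x t) (mK : forall t, measurable_fun D (K ^~ t)).

Lemma iterated_integral_le_L1 (M : R) :
  0 <= M -> mu.-integrable D (EFin \o w) ->
  (forall x t, D x -> D t -> K x t <= M) ->
  iterated_integral_le mu D w K (M * (\int[mu]_(x in D) w x) ^+ 2).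
Proof.
move=> M0 iw KM.
have mw : measurable_fun D w.
  by apply/measurable_EFinP; exact: (measurable_int _ iw).
have eqA : (\int[mu]_(x in D) (w x)%:E = (\int[mu]_(x in D) w x)%:E)%E.
  by rewrite fineK//; exact: integrable_fin_num.
exists (fun=> M * \int[mu]_(x in D) w x); split.
- exact: measurable_cst.
- move=> t Dt; rewrite EFinM -eqA -ge0_integralZl_EFin//; last 2 first.
  + by move=> x _; rewrite lee_fin.
  + exact/measurable_EFinP.
  apply: ge0_le_integral => //.
  + by move=> x _; rewrite lee_fin mulr_ge0.
  + by apply/measurable_EFinP; apply: measurable_funM => //; exact: mK.
  + by apply: measurable_funeM; exact/measurable_EFinP.
  + by move=> x Dx; rewrite -EFinM lee_fin mulrC ler_wpM2r// KM.
- under eq_integral do rewrite mulrC EFinM.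
  rewrite ge0_integralZl_EFin//; last 3 first.
  + by move=> x _; rewrite lee_fin.
  + exact/measurable_EFinP.
  + by rewrite mulr_ge0// Rintegral_ge0.
  by rewrite eqA -EFinM expr2 mulrA.
Qed.

Lemma integral_weight_le_Loo (C : R) (u : T -> R) :
  0 <= C -> measurable_fun D w -> {ae mu, forall x, D x -> w x <= C} ->
  measurable_fun D u -> (forall x, 0 <= u x) ->
  (\int[mu]_(x in D) (w x * u x)%:E <= C%:E * \int[mu]_(x in D) (u x)%:E)%E.
Proof.
move=> C0 mw aew m_u u0; rewrite -ge0_integralZl_EFin//; last 2 first.
- by move=> x _; rewrite lee_fin.
- exact/measurable_EFinP.
apply: ae_ge0_le_integral => //.
- by move=> x _; rewrite lee_fin mulr_ge0.
- by apply/measurable_EFinP; exact: measurable_funM.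
- by move=> x _; rewrite -EFinM lee_fin mulr_ge0.
- by apply: measurable_funeM; exact/measurable_EFinP.
- apply: filterS aew => x wC /wC {}wC.
  by rewrite -EFinM lee_fin ler_wpM2r.
Qed.

Lemma integrable_weight_Loo (C : R) :
  0 <= C -> measurable_fun D w -> {ae mu, forall x, D x -> w x <= C} ->
  (mu D < +oo)%E -> mu.-integrable D (EFin \o w).
Proof.
move=> C0 mw aew muD.
apply/integrableP; split; first exact/measurable_EFinP.
(* Taking u = 1 bounds the integral of w. *)
have := integral_weight_le_Loo _ (fun=> 1) C0 mw aew (measurable_cst _) (fun=> ler01).
rewrite integral_cst// mul1e => le1.
apply: (@le_lt_trans _ _ (C%:E * mu D)%E); last by rewrite lte_mul_pinfty.
apply: le_trans le1.
rewrite le_eqVlt; apply/orP; left; apply/eqP; apply: eq_integral => x _.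
by rewrite mulr1 /= ger0_norm.
Qed.

(** The weight is replaced by its essential bound C in the inner and then in
the outer integral, whence the square; J is the iterated integral of K. *)
Lemma iterated_integral_le_Loo (C : R) (j : T -> R) (J : R) :
  0 <= C -> measurable_fun D w -> {ae mu, forall x, D x -> w x <= C} ->
  measurable_fun D j -> (forall t, 0 <= j t) ->
  (forall t, D t -> \int[mu]_(x in D) (K x t)%:E = (j t)%:E)%E ->
  (\int[mu]_(t in D) (j t)%:E = J%:E)%E ->
  iterated_integral_le mu D w K (C ^+ 2 * J).
Proof.
move=> C0 mw aew mj j0 jE JE; exists (fun t => C * j t); split.
- exact: measurable_funM.
- move=> t Dt; rewrite EFinM -jE//.
  by apply: integral_weight_le_Loo => //; exact: mK.
- apply: le_trans (integral_weight_le_Loo _ _ C0 mw aew _ _) _.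
  + exact: measurable_funM.
  + by move=> t; rewrite mulr_ge0.
  under eq_integral do rewrite EFinM.
  rewrite ge0_integralZl_EFin//; last 2 first.
  + by move=> t _; rewrite lee_fin.
  + exact/measurable_EFinP.
  by rewrite JE -!EFinM expr2 mulrA.
Qed.

Section Lp.
Variables alpha beta : R.
Hypotheses (alpha0 : 0 < alpha) (beta0 : 0 < beta).
Hypothesis conj : alpha^-1 + beta^-1 = 1.
Hypothesis mw : measurable_fun D w.
Hypothesis iw : mu.-integrable D (EFin \o (fun x => w x `^ beta)).
Let V := \int[mu]_(x in D) (w x `^ beta).

Lemma integral_weight_le_Lp (u : T -> R) :
  measurable_fun D u -> (forall x, 0 <= u x) ->
  (\int[mu]_(x in D) (w x * u x)%:E <= (V `^ beta^-1)%:E *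
   (\int[mu]_(x in D) (u x `^ alpha)%:E) `^ alpha^-1)%E.
Proof.
move=> m_u u0; rewrite -poweR_EFin fineK; last exact: integrable_fin_num.
by apply: hoelder_integral => //; rewrite addrC.
Qed.

Lemma integrable_weight_Lp : (mu D < +oo)%E -> mu.-integrable D (EFin \o w).
Proof.
move=> muD; apply/integrableP; split; first exact/measurable_EFinP.
(* Taking u = 1 bounds the integral of w. *)
have := integral_weight_le_Lp (fun=> 1) (measurable_cst _) (fun=> ler01).
rewrite powR1 integral_cst// mul1e => le1.
apply: (@le_lt_trans _ _ ((V `^ beta^-1)%:E * (mu D) `^ alpha^-1)%E); last first.
  rewrite lte_mul_pinfty ?lee_fin ?powR_ge0//.
  exact: poweR_lty.
apply: le_trans le1.
rewrite le_eqVlt; apply/orP; left; apply/eqP; apply: eq_integral => x _.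
by rewrite mulr1 /= ger0_norm.
Qed.

(** Hoelder's inequality bounds the inner integral by N j(t)^(1/alpha), where N
is the beta-norm of w; applied again to w and j^(1/alpha) it bounds the outer
integral by N (N J^(1/alpha)), since (j^(1/alpha))^alpha = j. *)
Lemma iterated_integral_le_Lp (j : T -> R) (J : R) :
  measurable_fun D j -> (forall t, 0 <= j t) ->
  (forall t, D t -> \int[mu]_(x in D) (K x t `^ alpha)%:E = (j t)%:E)%E ->
  (\int[mu]_(t in D) (j t)%:E = J%:E)%E ->
  iterated_integral_le mu D w K ((V `^ beta^-1) ^+ 2 * J `^ alpha^-1).
Proof.
move=> mj j0 jE JE.
have mja : measurable_fun D (fun t => j t `^ alpha^-1).
  exact: (measurableT_comp (measurable_powR _)).
exists (fun t => V `^ beta^-1 * j t `^ alpha^-1); split.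
- exact: measurable_funM.
- move=> t Dt; rewrite EFinM -(poweR_EFin (j t)) -jE//.
  by apply: integral_weight_le_Lp; first exact: mK.
- under eq_integral do rewrite mulrCA EFinM.
  rewrite ge0_integralZl_EFin ?powR_ge0//; last 2 first.
  + by move=> t _; rewrite lee_fin mulr_ge0 ?powR_ge0.
  + by apply/measurable_EFinP; exact: measurable_funM.
  rewrite expr2 -mulrA 2!EFinM.
  apply: lee_wpmul2l; first by rewrite lee_fin powR_ge0.
  apply: le_trans (integral_weight_le_Lp _ mja _) _.
    by move=> t; exact: powR_ge0.
  apply: lee_wpmul2l; first by rewrite lee_fin powR_ge0.
  under eq_integral do rewrite -powRrM mulVf ?gt_eqF// powRr1//.
  by rewrite JE.
Qed.

End Lp.

End iterated_integral_bounds.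

(** * Iterated integral of a power of the distance *)

Lemma continuous_abs_powR (R : realType) (s : R) : 0 < s ->
  continuous (fun x : R => `|x| `^ s).
Proof.
move=> s0 x.
have [->|x0] := eqVneq x 0.
  rewrite /continuous_at normr0 powR0 ?gt_eqF//.
  apply/cvgrPdist_le => e e0.
  near=> y.
  rewrite sub0r normrN ger0_norm ?powR_ge0//.
  have -> : e = (e `^ (s^-1)) `^ s by rewrite -powRrM mulVf ?gt_eqF// powRr1// ltW.
  apply: ge0_ler_powR; rewrite ?nnegrE ?powR_ge0//; first exact: ltW.
  near: y.
  have e1 : 0 < e `^ s^-1 by rewrite powR_gt0.
  exact: (@nbhs0_le R R _ e1).
apply: (@continuous_comp _ _ _ (fun x : R => `|x|) (fun y => y `^ s)).
  exact: norm_continuous.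
apply: differentiable_continuous; apply/derivable1_diffP.
by apply: derivable_powR; rewrite in_itv/= andbT normr_gt0.
Unshelve. all: by end_near. Qed.

(** x |x|^s / (s + 1) is a primitive of |x|^s on the whole line, 0 included: there
the difference quotient is |x|^s itself, which tends to 0. With it no integral
has to be cut at the singular point. *)
Lemma is_derive_mul_abs_powR (R : realType) (s x : R) : 0 < s ->
  is_derive x 1 (fun x : R => x * `|x| `^ s) ((s + 1) * `|x| `^ s).
Proof.
move=> s0; have [x0|x0|->] := ltgtP x 0.
- apply: (@near_eq_is_derive R R R (fun y => y * (- y) `^ s)).
    near=> y; rewrite ltr0_norm//; near: y; exact: lt_nbhsl.
  have dN : is_derive x 1 (fun y : R => (- y) `^ s) (- (s * (- x) `^ (s - 1))).
    have Nx0 : 0 < - x by rewrite oppr_gt0.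
    have := @is_derive1_comp _ (fun y : R => y `^ s) -%R x _ _
      (is_derive1_powR s Nx0) (is_deriveNid x 1).
    by rewrite mulrN1.
  apply: is_derive_eq (is_deriveM (is_derive_id x 1) dN) _.
  rewrite ltr0_norm// /GRing.scale /= mulr1 mulrN.
  rewrite -(@mulr_powRB1 _ (- x) s) ?oppr_ge0 ?ltW//.
  by ring.
- apply: (@near_eq_is_derive R R R (fun y => y * y `^ s)).
    near=> y; rewrite gtr0_norm//; near: y; exact: lt_nbhsr.
  apply: is_derive_eq (is_deriveM (is_derive_id x 1) (is_derive1_powR s x0)) _.
  rewrite gtr0_norm// /GRing.scale /= mulr1 -(@mulr_powRB1 _ x s) ?ltW//.
  by ring.
- have c0 : (fun h : R => h^-1 *: ((h *: (1 : R) + 0 : R) * `|h *: (1 : R) + 0 : R| `^ s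
       - 0 * `|0 : R| `^ s)) @ 0^' --> (s + 1) * `|0 : R| `^ s.
    rewrite normr0 powR0 ?gt_eqF// !mulr0.
    apply: (@cvg_trans _ ((fun h : R => `|h| `^ s) @ 0^')).
      apply: near_eq_cvg; near=> h.
      have h0 : h != 0 by near: h; exact: nbhs_dnbhs_neq.
      by rewrite /GRing.scale /= mulr1 addr0 subr0 mulrA mulVf// mul1r.
    have := @continuous_abs_powR R s s0 0.
    rewrite /continuous_at normr0 powR0 ?gt_eqF//.
    exact: cvg_within_filter.
  apply: DeriveDef; first by apply/cvg_ex; exists ((s + 1) * `|0 : R| `^ s).
  exact: cvg_lim c0.
Unshelve. all: by end_near. Qed.

Lemma Leb_measurable_itv (R : realType) (a b : R) :
  measurable (`[a, b] : set (LebesgueR R)).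
Proof. by apply: sub_caratheodory; exact: measurable_itv. Qed.

(** The identity is measurable from the Lebesgue to the Borel sigma-algebra and
pushes the completed measure forward to the Borel one, so integrals of Borel
functions, hence the fundamental theorem of calculus, carry over. *)
Lemma Leb_integralE (R : realType) (a b : R) (f : R -> R) :
  measurable_fun setT f -> (forall x, 0 <= f x) ->
  (\int[Leb R]_(x in `[a, b]) (f x)%:E =
   \int[lebesgue_measure]_(x in `[a, b]) (f x)%:E)%E.
Proof.
move=> mf f0.
have mid : measurable_fun setT (id : LebesgueR R -> measurableTypeR R).
  by move=> _ Y mY; rewrite setTI preimage_id; exact: sub_caratheodory.
rewrite -[LHS](@ge0_integral_pushforward _ _ _ _ R _ mid (Leb R) `[a, b] (EFin \o f)).
- by apply: eq_measure_integral => A mA _.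
- exact: measurable_itv.
- by apply/measurable_EFinP; apply: measurable_funTS.
- by move=> x _; rewrite lee_fin.
Qed.

Lemma integral_dist_powR (R : realType) (a b t s : R) : a < b -> 0 < s ->
  a <= t <= b ->
  (\int[Leb R]_(x in `[a, b]) (`|x - t| `^ s)%:E =
   ((`|b - t| `^ (s + 1) + `|t - a| `^ (s + 1)) / (s + 1))%:E)%E.
Proof.
move=> ab s0 /andP[at_ tb].
have cont u : 0 < u -> continuous (fun x : R => `|x - t| `^ u).
  move=> u0 x; apply: (@continuous_comp _ _ _ (fun x => x - t) (fun y => `|y| `^ u)).
    by apply: cvgB; [exact: cvg_id|exact: cvg_cst].
  exact: continuous_abs_powR.
rewrite Leb_integralE; last 2 first.
- exact: continuous_measurable_fun (cont _ s0).
- by move=> x; exact: powR_ge0.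
(* The primitive of |x - t|^s given by is_derive_mul_abs_powR. *)
pose F x := (s + 1)^-1 * ((x - t) * `|x - t| `^ s).
have s1 : s + 1 != 0 by rewrite gt_eqF// ltr_wpDr.
have dF (x : R) : is_derive x (1 : R) F (`|x - t| `^ s).
  have d := @is_derive1_comp _ (fun y : R => y * `|y| `^ s) (fun x => x - t) x _ _
    (is_derive_mul_abs_powR _ s (x - t) s0)
    (is_deriveB (is_derive_id x 1) (is_derive_cst t x 1)).
  apply: is_derive_eq (is_deriveZ (s + 1)^-1 d) _.
  by rewrite /GRing.scale /= subr0 mulr1 mulKf.
have cF : continuous F.
  by move=> x; apply: differentiable_continuous; apply/derivable1_diffP; case: (dF x).
rewrite (@continuous_FTC2 _ _ F)//.
- rewrite -EFinB /F; congr _%:E.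
  rewrite -[b - t]ger0_norm ?subr_ge0// normr_id -(opprB t a) normrN.
  rewrite -[t - a]ger0_norm ?subr_ge0// normr_id.
  rewrite -!(@mulr_powRB1 _ _ (s + 1)) ?normr_ge0 ?addr_gt0// addrK.
  by rewrite [RHS]mulrC mulNr mulrN opprK -mulrDr.
- by apply: continuous_subspaceT; exact: cont.
- split; first by move=> x _; case: (dF x).
  + by apply: cvg_at_right_filter; exact: cF.
  + by apply: cvg_at_left_filter; exact: cF.
- by move=> x _; rewrite derive1E; case: (dF x).
Qed.

Lemma Leb_itv (R : realType) (a b : R) : a <= b ->
  Leb R `[a, b]%classic = (b - a)%:E.
Proof.
move=> ab; transitivity (lebesgue_measure (`[a, b]%classic : set R)); first by [].
rewrite lebesgue_measure_itv/= lte_fin; case: ltgtP ab => // -> _.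
by rewrite subrr.
Qed.

Lemma measurable_dist_powR (R : realType) (t s : R) (D : set (LebesgueR R)) :
  measurable_fun D (fun x : LebesgueR R => `|(x : R) - t| `^ s).
Proof.
have m : measurable_fun (setT : set R) (fun x : R => `|x - t| `^ s).
  apply: (measurableT_comp (measurable_powR _)).
  by apply: measurableT_comp => //; exact: measurable_funB.
by move=> mD Y mY; apply: measurableI => //; apply: sub_caratheodory;
  rewrite -[X in measurable X]setTI; exact: m.
Qed.

Lemma measurable_integral_dist_powR (R : realType) (a b s : R)
    (D : set (LebesgueR R)) : measurable_fun D
  (fun t : LebesgueR R =>
    (`|b - (t : R)| `^ (s + 1) + `|(t : R) - a| `^ (s + 1)) / (s + 1)).
Proof.
have mb : measurable_fun D (fun t : LebesgueR R => `|b - (t : R)| `^ (s + 1)).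
  rewrite (_ : (fun _ => _) = (fun t : LebesgueR R => `|(t : R) - b| `^ (s + 1))).
    exact: measurable_dist_powR.
  by apply/funext => t; rewrite distrC.
have ma := measurable_dist_powR R a (s + 1) D.
exact: (measurable_funM (measurable_funD mb ma) (measurable_cst _)).
Qed.

(** With the integral over x already computed (integral_dist_powR), the integral
over t is again one of a power of a distance, now to an end point. *)
Lemma double_integral_dist_powR (R : realType) (a b s : R) : a < b -> 0 < s ->
  (\int[Leb R]_(t in `[a, b])
     ((`|b - t| `^ (s + 1) + `|t - a| `^ (s + 1)) / (s + 1))%:E =
   (2 * (b - a) `^ (s + 2) / ((s + 1) * (s + 2)))%:E)%E.
Proof.
move=> ab s0.
have mD := Leb_measurable_itv R a b.
have s1 : 0 < s + 1 by rewrite addr_gt0.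
have I u : u = a \/ u = b -> (\int[Leb R]_(t in `[a, b]) (`|t - u| `^ (s + 1))%:E =
    ((b - a) `^ (s + 2) / (s + 2))%:E)%E.
  move=> uab; rewrite integral_dist_powR//; last first.
    by case: uab => ->; rewrite lexx ltW.
  have -> : s + 1 + 1 = s + 2 by rewrite -addrA.
  have s2 : s + 2 != 0 by rewrite gt_eqF// addr_gt0.
  by case: uab => ->; rewrite subrr normr0 powR0// ?addr0 ?add0r gtr0_norm// subr_gt0.
rewrite (eq_integral (fun t : LebesgueR R =>
    (s + 1)^-1%:E * (`|(t : R) - b| `^ (s + 1))%:E +
    (s + 1)^-1%:E * (`|(t : R) - a| `^ (s + 1))%:E)%E); last first.
  by move=> t _; rewrite -!EFinM -EFinD -mulrDr mulrC distrC.
rewrite ge0_integralD//; last 4 first.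
- by move=> x _; rewrite -EFinM lee_fin mulr_ge0 ?powR_ge0// invr_ge0 ltW.
- by apply: measurable_funeM; apply/measurable_EFinP; exact: measurable_dist_powR.
- by move=> x _; rewrite -EFinM lee_fin mulr_ge0 ?powR_ge0// invr_ge0 ltW.
- by apply: measurable_funeM; apply/measurable_EFinP; exact: measurable_dist_powR.
have Z u : (\int[Leb R]_(t in `[a, b]) ((s + 1)^-1%:E * (`|(t : R) - u| `^ (s + 1))%:E)
    = (s + 1)^-1%:E * \int[Leb R]_(t in `[a, b]) (`|t - u| `^ (s + 1))%:E)%E.
  apply: ge0_integralZl_EFin => //.
  - by apply/measurable_EFinP; exact: measurable_dist_powR.
  - by rewrite invr_ge0 ltW.
rewrite !Z !I; [|by left|by right].
rewrite -EFinM -EFinD; congr _%:E.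
have s2 : 0 < s + 2 by rewrite addr_gt0.
by field; rewrite !gt_eqF.
Qed.

(** * The functional as a weighted Chebyshev functional *)

Lemma holder_on_bounded (R : realType) (a b H p : R) (F : R -> R) :
  a <= b -> 0 < H -> 0 < p -> holder_on a b H p F ->
  forall x, x \in `[a, b] -> `|F x| <= `|F a| + H * (b - a) `^ p.
Proof.
move=> ab H0 p0 hF x xab; rewrite -[F x](subrK (F a)) addrC.
apply: le_trans (ler_normD _ _) _; rewrite lerD2l.
apply: le_trans (hF _ _ xab _) _; first by rewrite in_itv/= lexx.
move: xab; rewrite in_itv/= => /andP[ax xb].
rewrite ler_pM2l//; apply: ge0_ler_powR; rewrite ?nnegrE ?subr_ge0//.
  exact: ltW.
by rewrite ger0_norm ?subr_ge0// lerD2r.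
Qed.

(** The Hoelder conditions serve twice: they bound the differences of F = f / h
and G = g / h, and they make F and G bounded, so that integrability of h^2
alone makes all four integrals of the functional finite. *)
Lemma Pompeiu_Chebyshev_le_iterated_integral (R : realType) (a b : R) (f g h : R -> R)
    (p q H1 H2 c : R) :
  a < b ->
  Lebesgue_measurable_on a b f -> Lebesgue_measurable_on a b g ->
  Lebesgue_measurable_on a b h ->
  (forall s : R, s \in `[a, b] -> h s != 0) ->
  0 < p -> 0 < q -> 0 < H1 -> 0 < H2 ->
  holder_on a b H1 p (fun x => f x / h x) ->
  holder_on a b H2 q (fun x => g x / h x) ->
  (Leb R).-integrable `[a, b] (EFin \o (fun x => h x ^+ 2)) ->
  iterated_integral_le (Leb R) `[a, b] (fun x => h x ^+ 2)
    (fun x t => `|x - t| `^ (p + q)) c ->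
  (`|Pompeiu_Chebyshev a b h f g| <= (2^-1 * H1 * H2 * c)%:E)%E.
Proof.
move=> ab mf mg mh h0 p0 q0 H10 H20 hF hG iw kc.
set D := `[a, b]%classic : set (LebesgueR R).
have mD : measurable D := Leb_measurable_itv R a b.
pose F x := f x / h x; pose G x := g x / h x; pose w x := h x ^+ 2.
have DE x : D x -> x \in `[a, b] by [].
have w0 x : D x -> 0 <= w x by move=> _; exact: sqr_ge0.
have mw : measurable_fun D (w : LebesgueR R -> R).
  by apply/measurable_EFinP; exact: measurable_int iw.
have wFE : {in D, (fun x => f x * h x) =1 (fun x => w x * F x)}.
  move=> x /set_mem /DE /h0 hx; rewrite /w /F; field; exact: hx.
have wGE : {in D, (fun x => h x * g x) =1 (fun x => w x * G x)}.
  move=> x /set_mem /DE /h0 hx; rewrite /w /G; field; exact: hx.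
have wFGE : {in D, (fun x => f x * g x) =1 (fun x => w x * (F x * G x))}.
  move=> x /set_mem /DE /h0 hx; rewrite /w /F /G; field; exact: hx.
have bF x : D x -> `|F x| <= `|F a| + H1 * (b - a) `^ p.
  by move=> /DE; apply: holder_on_bounded => //; exact: ltW.
have bG x : D x -> `|G x| <= `|G a| + H2 * (b - a) `^ q.
  by move=> /DE; apply: holder_on_bounded => //; exact: ltW.
have ibd (phi : LebesgueR R -> R) C :
    measurable_fun D (fun x : LebesgueR R => w x * phi x) ->
    (forall x, D x -> `|phi x| <= C) ->
    (Leb R).-integrable D (EFin \o (fun x => w x * phi x)).
  move=> mphi bphi; apply: (le_integrable mD _ _ (integrableZl mD C iw)).
    exact/measurable_EFinP.
  move=> x Dx /=; rewrite lee_fin normrM.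
  rewrite [leRHS]normrM mulrC ler_wpM2r ?normr_ge0//.
  exact: le_trans (bphi _ Dx) (ler_norm _).
have iF : (Leb R).-integrable D (EFin \o (fun x => w x * F x)).
  by apply: ibd bF; apply: eq_measurable_fun wFE _; exact: measurable_funM.
have iG : (Leb R).-integrable D (EFin \o (fun x => w x * G x)).
  by apply: ibd bG; apply: eq_measurable_fun wGE _; exact: measurable_funM.
have iFG : (Leb R).-integrable D (EFin \o (fun x => w x * (F x * G x))).
  apply: (ibd _ ((`|F a| + H1 * (b - a) `^ p) * (`|G a| + H2 * (b - a) `^ q))).
    by apply: eq_measurable_fun wFGE _; exact: measurable_funM.
  by move=> x Dx; rewrite normrM ler_pM// ?bF ?bG.
have eqR phi : (Leb R).-integrable D (EFin \o phi) ->
    (\int[Leb R]_(x in D) (phi x)%:E = (\int[Leb R]_(x in D) phi x)%:E)%E.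
  by move=> iphi; rewrite fineK//; exact: integrable_fin_num.
have -> : Pompeiu_Chebyshev a b h f g =
    ((\int[Leb R]_(x in D) w x) * (\int[Leb R]_(x in D) (w x * (F x * G x)))
     - (\int[Leb R]_(x in D) (w x * F x)) * (\int[Leb R]_(x in D) (w x * G x)))%:E.
  rewrite EFinB !EFinM -!eqR//.
  congr (_ * _ - _ * _)%E; apply: eq_integral => x xD; congr EFin.
  - exact: wFGE.
  - exact: wFE.
  - exact: wGE.
rewrite lee_fin.
have -> : 2^-1 * H1 * H2 * c = 2^-1 * (H1 * H2 * c) by rewrite !mulrA.
rewrite -[leLHS](mulKf (x := 2))// ler_pM2l ?invr_gt0//.
apply: (@chebyshev_le_iterated_integral _ _ _ (Leb R) D mD w F G
  (fun x t => `|x - t| `^ (p + q)) (H1 * H2) c w0 iw iF iG iFG _ _ _ kc).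
- exact: mulr_gt0.
- by move=> t; exact: measurable_dist_powR.
- move=> x t Dx Dt; rewrite normrM.
  rewrite powRD; last by rewrite gt_eqF// addr_gt0.
  by rewrite mulrACA ler_pM ?normr_ge0//; [exact: hF|exact: hG].
Qed.

(** * Norms of h and the constants *)

Lemma in_Lp_integrable (R : realType) (a b p : R) (h : R -> R) :
  1 <= p -> in_Lp a b p%:E h ->
  (Leb R).-integrable `[a, b] (EFin \o (fun x => `|h x| `^ p)) /\
  Lp_norm a b p%:E h =
    ((\int[Leb R]_(x in `[a, b]) (`|h x| `^ p)) `^ p^-1)%:E.
Proof.
move=> p1 hLp.
have p0 : p != 0 by rewrite gt_eqF// (lt_le_trans ltr01).
have E : (fun x => (`|(h \_ `[a, b]) x| `^ p)%:E) =
    (EFin \o (fun x => `|h x| `^ p)) \_ `[a, b].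
  apply/funext => x; rewrite /= !patchE; case: ifPn => // _.
  by rewrite normr0 powR0.
have ih : (Leb R).-integrable `[a, b] (EFin \o (fun x => `|h x| `^ p)).
  apply/(integrable_mkcond _ (Leb_measurable_itv R a b)); rewrite -E.
  exact: Lfun_integrable hLp.
split => //; rewrite /Lp_norm unlock.
rewrite -poweR_EFin fineK; last first.
  by apply: (integrable_fin_num (Leb_measurable_itv R a b)) ih.
congr (_ `^ _)%E; rewrite [RHS]integral_mkcond.
by apply: eq_integral => x _; rewrite -E.
Qed.

Lemma in_Loo_ae (R : realType) (a b : R) (h : R -> R) : a < b ->
  in_Lp a b +oo%E h ->
  exists2 M : R, Lp_norm a b +oo h = M%:E &
    0 <= M /\ {ae Leb R, forall x, x \in `[a, b] -> h x ^+ 2 <= M ^+ 2}.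
Proof.
move=> ab; rewrite /in_Lp inE => /andP[_]; rewrite inE /= /finite_norm => hoo.
have h0 : (0 <= 'N[Leb R]_+oo [EFin \o (h \_ `[a, b])])%E := Lnorm_ge0 _ _ _.
exists (fine (Lp_norm a b +oo h)).
  by rewrite fineK// ge0_fin_numE.
split; first exact: fine_ge0.
have muT : (0 < Leb R [set: LebesgueR R])%E.
  apply: (@lt_le_trans _ _ (Leb R (`[a, b]%classic : set (LebesgueR R)))).
    by rewrite Leb_itv ?ltW// lte_fin subr_gt0.
  apply: le_measure; rewrite ?inE//; exact: Leb_measurable_itv.
have NE : 'N[Leb R]_+oo [EFin \o (h \_ `[a, b])]%E =
    ess_sup (Leb R) (abse \o (EFin \o (h \_ `[a, b]))).
  by rewrite unlock muT.
have := ess_sup_ge (Leb R) (abse \o (EFin \o (h \_ `[a, b]))).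
apply: filterS => x /= hx xab.
rewrite -real_normK ?num_real// ler_pXn2r ?nnegrE//; last exact: fine_ge0.
rewrite -lee_fin fineK; last by rewrite ge0_fin_numE.
rewrite /Lp_norm NE; move: hx; rewrite patchE mem_set//.
Qed.

(** Both products of two factors with the same constant c satisfy
(2 x + c) (2 y + c) <= (x + y + c)^2, with difference (x - y)^2. *)
Lemma four_factors_le (R : realType) (x y : R) : 0 <= x -> 0 <= y ->
  (2 * x + 1) * (2 * x + 2) * (2 * y + 1) * (2 * y + 2)
    <= ((x + y + 1) * (x + y + 2)) ^+ 2.
Proof.
move=> x0 y0.
have -> : (2 * x + 1) * (2 * x + 2) * (2 * y + 1) * (2 * y + 2) =
  ((2 * x + 1) * (2 * y + 1)) * ((2 * x + 2) * (2 * y + 2)) by ring.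
have H c : 0 <= c -> 0 <= (2 * x + c) * (2 * y + c) <= (x + y + c) ^+ 2.
  move=> c0; rewrite mulr_ge0 ?addr_ge0 ?mulr_ge0//=.
  by rewrite -subr_ge0 (_ : _ - _ = (x - y) ^+ 2) ?sqr_ge0//; ring.
rewrite exprMn; have /andP[A B] := H 1 ler01; have /andP[C D] := H 2 (ler0n _ _).
exact: ler_pM.
Qed.

Theorem theorem8 (R : realType) (a b : R) (f g h : R -> R)
    (p q H1 H2 alpha beta : R)
    (hab : a < b)
    (mf : Lebesgue_measurable_on a b f)
    (mg : Lebesgue_measurable_on a b g)
    (mh : Lebesgue_measurable_on a b h)
    (h0 : forall s : R, s \in `[a, b] -> h s != 0)
    (hp : 0 < p <= 1) (hq : 0 < q <= 1)
    (hH1 : 0 < H1) (hH2 : 0 < H2)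
    (holf : holder_on a b H1 p (fun x => f x / h x))
    (holg : holder_on a b H2 q (fun x => g x / h x))
    (halpha : 1 < alpha) (hbeta : alpha^-1 + beta^-1 = 1) :
  [/\ in_Lp a b +oo%E h ->
      (`|Pompeiu_Chebyshev a b h f g| <=
         (H1 * H2 * ((b - a) `^ (p + q + 2) /
            Num.sqrt ((2 * p + 1) * (2 * p + 2) * (2 * q + 1) * (2 * q + 2))))%:E
         * Lp_norm a b +oo h ^+ 4)%E,
      in_Lp a b (2 * beta)%:E h ->
      (`|Pompeiu_Chebyshev a b h f g| <=
         (H1 * H2 * (2 `^ (- beta^-1) * (b - a) `^ (p + q + 2 / alpha) /
            ((2 * alpha * p + 1) * (2 * alpha * p + 2) *
             (2 * alpha * q + 1) * (2 * alpha * q + 2)) `^ (2 * alpha)^-1))%:E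
         * Lp_norm a b (2 * beta)%:E h ^+ 4)%E &
      in_Lp a b 2%:E h ->
      (`|Pompeiu_Chebyshev a b h f g| <=
         (2^-1 * H1 * H2 * (b - a) `^ (p + q))%:E
         * Lp_norm a b 2%:E h ^+ 4)%E].
Proof.
move: hp hq => /andP[p0 p1] /andP[q0 q1].
have r0 : 0 < p + q by rewrite addr_gt0.
have alpha0 : 0 < alpha by rewrite (lt_trans ltr01).
have beta0 : 0 < beta.
  rewrite -invr_gt0 -(addKr alpha^-1 beta^-1) hbeta addrC subr_gt0.
  by rewrite invf_lt1.
have w0 x : 0 <= h x ^+ 2 by exact: sqr_ge0.
have mw : Lebesgue_measurable_on a b (fun x => h x ^+ 2).
  exact: measurable_funX.
set D := `[a, b]%classic : set (LebesgueR R).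
have mD : measurable D := Leb_measurable_itv R a b.
have muD : (Leb R D < +oo)%E by rewrite Leb_itv ?ltry// ltW.
pose w x := h x ^+ 2; pose K (x t : R) := `|x - t| `^ (p + q).
have K0 x t : 0 <= K x t by exact: powR_ge0.
have mK t : measurable_fun D (K ^~ t) by exact: measurable_dist_powR.
(* By integral_dist_powR, j s t is the integral of |x - t|^s over x. *)
pose j s t := (`|b - t| `^ (s + 1) + `|t - a| `^ (s + 1)) / (s + 1).
have mj s : measurable_fun D (j s) by exact: measurable_integral_dist_powR.
have j0 s t : 0 < s -> 0 <= j s t.
  by move=> s0; rewrite divr_ge0 ?addr_ge0 ?powR_ge0// ltW.
have key c : (Leb R).-integrable D (EFin \o w) ->
    iterated_integral_le (Leb R) D w K c ->
    (`|Pompeiu_Chebyshev a b h f g| <= (2^-1 * H1 * H2 * c)%:E)%E.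
  by move=> iw; apply: Pompeiu_Chebyshev_le_iterated_integral.
have H12 : 0 < H1 * H2 by rewrite mulr_gt0.
split.
- move=> /(in_Loo_ae _ _ _ _ hab) [M NE [M0 aew]].
  have iw := integrable_weight_Loo _ (Leb R) D w mD w0 _ (sqr_ge0 M) mw aew muD.
  have /(key _ iw) Ple : iterated_integral_le (Leb R) D w K
      ((M ^+ 2) ^+ 2 * (2 * (b - a) `^ (p + q + 2) / ((p + q + 1) * (p + q + 2)))).
    apply: (iterated_integral_le_Loo _ (Leb R) D w K mD w0 K0 mK _ (j (p + q))) => //.
    + exact: sqr_ge0.
    + by move=> t; exact: j0.
    + by move=> t; rewrite /D /= in_itv/= => tab; exact: integral_dist_powR.
    + exact: double_integral_dist_powR.
  apply: le_trans Ple _; rewrite NE -EFin_expe -EFinM lee_fin.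
  set N := (p + q + 1) * (p + q + 2).
  set Q := (2 * p + 1) * _ * _ * _.
  have N0 : 0 < N by rewrite mulr_gt0 ?addr_gt0.
  have Q0 : 0 < Q by rewrite !mulr_gt0 ?addr_gt0 ?mulr_gt0.
  have QN : Num.sqrt Q <= N.
    rewrite -[N]ger0_norm ?(ltW N0)// -sqrtr_sqr ler_sqrt ?exprn_ge0 ?(ltW N0)//.
    exact: four_factors_le (ltW p0) (ltW q0).
  have -> : 2^-1 * H1 * H2 * ((M ^+ 2) ^+ 2 * (2 * (b - a) `^ (p + q + 2) / N))
      = H1 * H2 * ((b - a) `^ (p + q + 2) / N) * M ^+ 4.
    by field; rewrite gt_eqF.
  rewrite ler_wpM2r ?exprn_ge0// ler_pM2l// ler_wpM2l ?powR_ge0//.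
  by rewrite lef_pV2 ?posrE ?sqrtr_gt0.
- have beta1 : 1 <= 2 * beta.
    have : beta^-1 <= 1 by rewrite -hbeta lerDr invr_ge0 ltW.
    rewrite invf_le1// => b1; apply: le_trans b1 _.
    by rewrite ler_peMl ?ler1n// ltW.
  move=> /(in_Lp_integrable _ _ _ _ _ beta1) [ih NE].
  have hE : (fun x => `|h x| `^ (2 * beta)) = (fun x => (h x ^+ 2) `^ beta).
    apply/funext => x; rewrite powRrM powR_mulrn ?normr_ge0//.
    by rewrite real_normK// num_real.
  rewrite {}hE in ih NE.
  have iw := integrable_weight_Lp _ (Leb R) D w mD w0 alpha beta
    alpha0 beta0 hbeta mw ih muD.
  have s0 : 0 < alpha * (p + q) by rewrite mulr_gt0.
  have /(key _ iw) Ple : iterated_integral_le (Leb R) D w K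
      (((\int[Leb R]_(x in D) (w x `^ beta)) `^ beta^-1) ^+ 2 *
       (2 * (b - a) `^ (alpha * (p + q) + 2) /
        ((alpha * (p + q) + 1) * (alpha * (p + q) + 2))) `^ alpha^-1).
    apply: (iterated_integral_le_Lp _ (Leb R) D w K mD w0 K0 mK _ _
      alpha0 beta0 hbeta mw ih (j (alpha * (p + q)))) => //.
    + by move=> t; exact: j0.
    + move=> t; rewrite /D /= in_itv/= => tab.
      under eq_integral do rewrite /K -powRrM mulrC.
      exact: integral_dist_powR.
    + exact: double_integral_dist_powR.
  apply: le_trans Ple _; rewrite NE -EFin_expe -EFinM lee_fin.
  set V := \int[_]_(_ in _) _.
  have V0 : 0 <= V by apply: Rintegral_ge0 => x _; exact: powR_ge0.
  have VE : (V `^ (2 * beta)^-1) ^+ 4 = (V `^ beta^-1) ^+ 2.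
    rewrite invfM mulrC powRrM (_ : 4 = 2 * 2)%N// exprM; congr (_ ^+ 2).
    by rewrite -powR_mulrn ?powR_ge0// -powRrM mulVf// powRr1 ?powR_ge0.
  rewrite {}VE.
  set N := (alpha * (p + q) + 1) * (alpha * (p + q) + 2).
  set Q := (2 * alpha * p + 1) * _ * _ * _.
  have N0 : 0 < N by rewrite mulr_gt0 ?addr_gt0 ?mulr_gt0.
  have Q0 : 0 < Q by rewrite !mulr_gt0 ?addr_gt0 ?mulr_gt0.
  have QN : Q `^ (2 * alpha)^-1 <= N `^ alpha^-1.
    have -> : N `^ alpha^-1 = (N ^+ 2) `^ (2 * alpha)^-1.
      rewrite -powR_mulrn ?(ltW N0)// -powRrM; congr (_ `^ _).
      by field; rewrite gt_eqF.
    apply: ge0_ler_powR; rewrite ?nnegrE.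
    + by rewrite invr_ge0 mulr_ge0 ?ltW.
    + exact: ltW.
    + exact: sqr_ge0.
    have assoc z : 2 * alpha * z = 2 * (alpha * z) by rewrite mulrA.
    rewrite /Q /N !assoc (mulrDr alpha).
    by apply: four_factors_le; rewrite mulr_ge0 ?ltW.
  rewrite powRM ?mulr_ge0 ?powR_ge0 ?invr_ge0 ?(ltW N0)//.
  rewrite powRM ?powR_ge0// -powRrM.
  have -> : (alpha * (p + q) + 2) * alpha^-1 = p + q + 2 / alpha.
    by field; rewrite gt_eqF.
  have -> : N^-1 `^ alpha^-1 = (N `^ alpha^-1)^-1.
    by rewrite -powR_inv1 ?(ltW N0)// powRAC powR_inv1 ?powR_ge0.
  (* Korkine's factor 1/2 joins the 2 of the iterated integral. *)
  have two : 2^-1 * 2 `^ alpha^-1 = 2 `^ (- beta^-1) :> R.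
    rewrite -powR_inv1// -powRD ?pnatr_eq0 ?implybT//; congr (_ `^ _).
    by rewrite -hbeta opprD addrAC addNr add0r.
  rewrite -two.
  set S := 2 `^ alpha^-1; set B := (b - a) `^ _; set W := (V `^ _) ^+ 2.
  have -> : 2^-1 * H1 * H2 * (W * (S * B / N `^ alpha^-1)) =
    H1 * H2 * (2^-1 * S * B / N `^ alpha^-1) * W.
    by field; rewrite gt_eqF// powR_gt0.
  rewrite ler_wpM2r ?exprn_ge0 ?powR_ge0// ler_pM2l//.
  rewrite ler_wpM2l ?mulr_ge0 ?invr_ge0 ?powR_ge0//.
  by rewrite lef_pV2 ?posrE ?powR_gt0.
- move=> /(in_Lp_integrable _ _ _ _ _ (ler1n R 2)) [ih NE].
  have hE : (fun x => `|h x| `^ 2) = (fun x => h x ^+ 2).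
    apply/funext => x; rewrite powR_mulrn ?normr_ge0//.
    by rewrite real_normK// num_real.
  rewrite {}hE in ih NE.
  have /(key _ ih) Ple : iterated_integral_le (Leb R) D w K
      ((b - a) `^ (p + q) * (\int[Leb R]_(x in D) w x) ^+ 2).
    apply: (iterated_integral_le_L1 _ (Leb R) D w K mD w0 K0 mK) => //.
      exact: powR_ge0.
    move=> x t; rewrite /D /= !in_itv/= => /andP[ax xb] /andP[at_ tb].
    apply: ge0_ler_powR; rewrite ?nnegrE//; first exact: ltW.
      by rewrite subr_ge0 ltW.
    by rewrite ler_norml opprB; apply/andP; split; rewrite lerB.
  apply: le_trans Ple _; rewrite NE -EFin_expe -EFinM lee_fin.
  set V := \int[_]_(_ in _) _.
  have V0 : 0 <= V by apply: Rintegral_ge0 => x _; exact: sqr_ge0.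
  have -> : (V `^ 2^-1) ^+ 4 = V ^+ 2.
    by rewrite powR12_sqrt// (_ : 4 = 2 * 2)%N// exprM sqr_sqrtr.
  by rewrite !mulrA.
Qed.
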